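(* Let $n>0$ and let $S\subseteq\mathbb{N}^{\mathbb{N}}$. Then $S$ is $\mathbf{\Sigma}_n^0$ (resp. $\mathbf{\Pi}_n^0$) if and only if $S$ is defined by a $\Sigma_n$ (resp. $\Pi_n$) sentence of $\mathscr{L}_{Bor}$.
   Context: $\mathbb{N}=\{0,1,2,\dots\}$; $\mathbb{N}^{<\mathbb{N}}$ is the set of finite sequences of naturals; $\langle\rangle$ is the empty sequence; $\mathbf{\Sigma}^0_n,\mathbf{\Pi}^0_n$ are the (boldface) finite levels of the Borel hierarchy on Baire space $\mathbb{N}^{\mathbb{N}}$. Extended variadic language: a first-order language together with various $n$-ary-by-variadic function symbols (for various $n\geq 0$), a constant symbol $\mathbf{k}$ for every $k\in\mathbb{N}$, and a special symbol $\cdots_x$ for every variable $x$ (different kinds of symbols being distinct, so that terms are uniquely readable). A structure for it is a structure $\mathscr{M}$ for the first-order part, with universe $\mathbb{N}$ and interpreting each $\mathbf{k}$ as $k$, together with a function $G^{\mathscr{M}}:\mathbb{N}^n\times\mathbb{N}^{<\mathbb{N}}\to\mathbb{N}$ for every $n$-ary-by-variadic function symbol $G$. For $k\in\mathbb{N}$, $\overline{k}$ also denotes $\mathbf{k}$. Terms: constant symbols; variables; $f(u_1,\dots,u_k)$ for a $k$-ary function symbol $f$ and terms $u_i$; and, for an $n$-ary-by-variadic $G$ and terms $w_1,\dots,w_n$: $G(w_1,\dots,w_n,u_1,\dots,u_m)$ for terms $u_1,\dots,u_m$, and $G(w_1,\dots,w_n,u(\mathbf{0})\cdots_x u(v))$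 for terms $u,v$ and a variable $x$. The last has free variables $FV(w_1)\cup\dots\cup FV(w_n)\cup(FV(u)\setminus\{x\})\cup FV(v)$ (the ellipsis $\cdots_x$ binds $x$ in $u$ only). Substitution $r(x|t)$ of $t$ for $x$ is as usual, with: if $r$ is $G(w_1,\dots,w_n,u(\mathbf{0})\cdots_y u(v))$, then $r(x|t)$ is obtained by replacing each $w_i$ by $w_i(x|t)$, $v$ by $v(x|t)$, and, when $y\neq x$, $u$ by $u(x|t)$ (if $y=x$, $u$ is unchanged). Interpretation $t^s$ under an assignment $s$ (a map from variables to $\mathbb{N}$), by recursion on complexity: usual for constants, variables and explicit argument lists, and $$G(w_1,\dots,w_n,u(\mathbf{0})\cdots_x u(v))^s=G^{\mathscr{M}}(w_1^s,\dots,w_n^s,u(x|\mathbf{0})^s,u(x|\mathbf{1})^s,\dots,u(x|\overline{v^s})^s).$$ Formulas and satisfaction are then as in first-order logic with equality: $\mathscr{M}\models(u=v)[s]$ iff $u^s=v^s$, with the usual clauses for connectives and quantifiers. $\mathscr{L}_{Bor}$ is the extended variadic language with a special unary function symbol $\mathbf{f}$ along with, for every $n>0$ and every $\iota:\mathbb{N}^n\to\mathbb{N}^{<\mathbb{N}}\setminus\{\langle\rangle\}$, an $n$-ary function symbol $\ell_\iota$ and an $n$-ary-by-variadic function symbol $\tau_\iota$. For $f:\mathbb{N}\to\mathbb{N}$, $\mathscr{M}_f$ is the $\mathscr{L}_{Bor}$-structure which interprets $\mathbf{f}$ as $f$ and, for all such $n,\iota$, interprets $\ell_\iota^{\mathscr{M}_f}(a_1,\dots,a_n)$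 = the length of $\iota(a_1,\dots,a_n)$, minus $1$; and $\tau_\iota^{\mathscr{M}_f}(a_1,\dots,a_n,b_1,\dots,b_m)=1$ if $(b_1,\dots,b_m)=\iota(a_1,\dots,a_n)$, and $0$ otherwise. An $\mathscr{L}_{Bor}$-sentence $\phi$ defines $S\subseteq\mathbb{N}^{\mathbb{N}}$ if for every $f:\mathbb{N}\to\mathbb{N}$: $f\in S$ if and only if $\mathscr{M}_f\models\phi$. A $\Sigma_n$ (resp. $\Pi_n$) sentence is a prenex sentence with $n$ alternating blocks of quantifiers, beginning with $\exists$ (resp. $\forall$), followed by a quantifier-free formula. *)

(* Defs.v *)
(* MathComp / MathComp-Analysis *)
From mathcomp Require Import all_boot all_classical topology.

Set Implicit Arguments.
Unset Strict Implicit.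
Unset Printing Implicit Defensive.

Local Open Scope classical_set_scope.
Local Open Scope nat_scope.

Section BorelHierarchy.
Context {T : topologicalType}.

(* Levels are numbered from 1; level 0 is a dummy. *)
Fixpoint Sigma0 (n : nat) : set (set T) :=
  match n with
  | 0 => set0
  | 1 => open
  | m.+1 => [set A | exists2 F : nat -> set T,
                       (forall i, Sigma0 m (~` F i)) & A = \bigcup_i F i]
  end.

Definition Pi0 (n : nat) : set (set T) := [set A | Sigma0 n (~` A)].

Lemma Sigma0SS n (A : set T) :
  Sigma0 n.+2 A <->
  exists2 F : nat -> set T, (forall i, Pi0 n.+1 (F i)) & A = \bigcup_i F i.
Proof. by []. Qed.

End BorelHierarchy.

(* [fun_symb k]: k-ary function symbols; [rel_symb k]: k-ary relation symbols;
   [var_symb n]: n-ary-by-variadic function symbols.  The constant symbols for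
   the naturals and the ellipses are constructors of [term], so they are
   automatically distinct from all of these. *)
Record language := Language {
  fun_symb : nat -> Type;
  rel_symb : nat -> Type;
  var_symb : nat -> Type }.

(* Variables are represented by natural numbers. *)
Inductive term (L : language) : Type :=
| Const (k : nat)
| Var (x : nat)
| App k (f : fun_symb L k) (u : 'I_k -> term L)
| VApp n (G : var_symb L n) (w : 'I_n -> term L) m (u : 'I_m -> term L)
  (* G(w_1, ..., w_n, u(0) ..._x u(v)) *)
| Ellipsis n (G : var_symb L n) (w : 'I_n -> term L) (x : nat) (u v : term L).

Arguments Const {L} k.
Arguments Var {L} x.

Inductive formula (L : language) : Type :=
| Eq (t u : term L)
| Rel k (R : rel_symb L k) (u : 'I_k -> term L)
| Not (p : formula L)
| And (p q : formula L)
| Or (p q : formula L)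
| Imp (p q : formula L)
| Iff (p q : formula L)
| All (x : nat) (p : formula L)
| Ex (x : nat) (p : formula L).

(* The universe is always nat, and Const k always denotes k. *)
Record structure (L : language) := Structure {
  fun_interp : forall k, fun_symb L k -> k.-tuple nat -> nat;
  rel_interp : forall k, rel_symb L k -> k.-tuple nat -> Prop;
  var_interp : forall n, var_symb L n -> n.-tuple nat -> seq nat -> nat }.

Section Syntax.
Context {L : language}.
Implicit Types (t : term L) (p : formula L).

Fixpoint FV t : set nat :=
  match t with
  | Const _ => set0
  | Var x => [set x]
  | App _ _ u => \bigcup_i FV (u i)
  | VApp _ _ w _ u => \bigcup_i FV (w i) `|` \bigcup_i FV (u i)
  | Ellipsis _ _ w x u v => \bigcup_i FV (w i) `|` (FV u `\ x) `|` FV v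
  end.

Fixpoint subst (x : nat) (t r : term L) {struct r} : term L :=
  match r with
  | Const k => Const k
  | Var y => if y == x then t else Var y
  | App _ f u => App f (fun i => subst x t (u i))
  | VApp _ G w _ u =>
      VApp G (fun i => subst x t (w i)) (fun i => subst x t (u i))
  | Ellipsis _ G w y u v =>
      Ellipsis G (fun i => subst x t (w i)) y
        (if y == x then u else subst x t u) (subst x t v)
  end.

Fixpoint depth t : nat :=
  match t with
  | Const _ | Var _ => 0
  | App k _ u => (\max_(i < k) depth (u i)).+1
  | VApp n _ w m u =>
      (maxn (\max_(i < n) depth (w i)) (\max_(i < m) depth (u i))).+1
  | Ellipsis n _ w _ u v =>
      (maxn (\max_(i < n) depth (w i)) (maxn (depth u) (depth v))).+1
  end.

Fixpoint FVf p : set nat :=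
  match p with
  | Eq t u => FV t `|` FV u
  | Rel _ _ u => \bigcup_i FV (u i)
  | Not p => FVf p
  | And p q | Or p q | Imp p q | Iff p q => FVf p `|` FVf q
  | All x p | Ex x p => FVf p `\ x
  end.

Definition sentence p := FVf p = set0.

Fixpoint quantifier_free p : Prop :=
  match p with
  | Eq _ _ | Rel _ _ _ => True
  | Not p => quantifier_free p
  | And p q | Or p q | Imp p q | Iff p q =>
      quantifier_free p /\ quantifier_free q
  | All _ _ | Ex _ _ => False
  end.

Definition quantifier (b : bool) : nat -> formula L -> formula L :=
  if b then @Ex L else @All L.

(* n alternating nonempty blocks of quantifiers followed by a quantifier-free
   formula; the first block is existential if b, universal otherwise. *)
Fixpoint prenex (b : bool) (n : nat) p : Prop :=
  match n with
  | 0 => quantifier_free p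
  | m.+1 => exists (xs : seq nat) (q : formula L),
      [/\ xs != [::], prenex (~~ b) m q & p = foldr (quantifier b) q xs]
  end.

Definition is_Sigma (n : nat) p := sentence p /\ prenex true n p.
Definition is_Pi (n : nat) p := sentence p /\ prenex false n p.

End Syntax.

Section Semantics.
Context {L : language} (M : structure L).
Implicit Types (s : nat -> nat) (t : term L) (p : formula L).

(* The recursive calls on u(x|k) are not structural, so the recursion is on a
   bound d for the depth of the term, which substituting constants preserves.
   Lemmas interp_Const to interp_Ellipsis give the defining equations of
   [interp]. *)
Fixpoint interp_rec (d : nat) s t {struct d} : nat :=
  match t with
  | Const k => k
  | Var x => s x
  | App k f u =>
      if d is d'.+1 then
        fun_interp M f [tuple interp_rec d' s (u i) | i < k]
      else 0
  | VApp n G w m u =>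
      if d is d'.+1 then
        var_interp M G [tuple interp_rec d' s (w i) | i < n]
                       [tuple interp_rec d' s (u i) | i < m]
      else 0
  | Ellipsis n G w x u v =>
      if d is d'.+1 then
        var_interp M G [tuple interp_rec d' s (w i) | i < n]
          [seq interp_rec d' s (subst x (Const k) u)
          | k <- iota 0 (interp_rec d' s v).+1]
      else 0
  end.

Definition interp s t : nat := interp_rec (depth t) s t.

Lemma depth_subst x k t : depth (subst x (Const k) t) = depth t.
Proof.
elim: t => //= [y|n f u IHu|n G w IHw m u IHu|n G w IHw y u IHu v IHv].
- by case: (y == x).
- by congr _.+1; apply: eq_bigr => i _; exact: IHu.
- by congr (maxn _ _).+1; apply: eq_bigr => i _; [exact: IHw|exact: IHu].
- congr (maxn _ _).+1; first by apply: eq_bigr => i _; exact: IHw.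
  by rewrite IHv; case: (y == x); rewrite ?IHu.
Qed.

Lemma leq_depth k (u : 'I_k -> term L) i :
  depth (u i) <= \max_(j < k) depth (u j).
Proof. exact: (leq_bigmax (F := fun j => depth (u j))). Qed.

Lemma interp_rec_bound d e s t :
  depth t <= d -> depth t <= e -> interp_rec d s t = interp_rec e s t.
Proof.
elim: d e t => [|d IH] [|e] [k|x|k f u|n G w m u|n G w x u v] //=.
- rewrite !ltnS => ud ue; congr fun_interp; congr mktuple; apply/funext => i.
  by apply: IH; apply: (leq_trans (leq_depth u i)).
- rewrite !ltnS !geq_max => /andP[wd ud] /andP[we ue].
  congr var_interp; [congr mktuple; apply/funext|apply: eq_map] => i; apply: IH.
  + exact: leq_trans (leq_depth w i) wd.
  + exact: leq_trans (leq_depth w i) we.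
  + exact: leq_trans (leq_depth u i) ud.
  + exact: leq_trans (leq_depth u i) ue.
- rewrite !ltnS !geq_max => /and3P[wd ud vd] /and3P[we ue ve].
  congr var_interp.
    congr mktuple; apply/funext => i; apply: IH.
      exact: leq_trans (leq_depth w i) wd.
    exact: leq_trans (leq_depth w i) we.
  by rewrite (IH e v)//; congr cons; [|apply: eq_map => k]; apply: IH;
    rewrite depth_subst.
Qed.

Lemma interp_recE d s t : depth t <= d -> interp_rec d s t = interp s t.
Proof. by move=> td; apply: interp_rec_bound. Qed.

Lemma interp_Const s k : interp s (Const k) = k. Proof. by []. Qed.

Lemma interp_Var s x : interp s (Var x) = s x. Proof. by []. Qed.

Lemma interp_App s k (f : fun_symb L k) u :
  interp s (App f u) = fun_interp M f [tuple interp s (u i) | i < k].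
Proof.
rewrite {1}/interp /=; congr fun_interp; congr mktuple; apply/funext => i.
by rewrite interp_recE// leq_depth.
Qed.

Lemma interp_VApp s n (G : var_symb L n) w m (u : 'I_m -> term L) :
  interp s (VApp G w u) =
  var_interp M G [tuple interp s (w i) | i < n] [tuple interp s (u i) | i < m].
Proof.
rewrite {1}/interp /=; congr var_interp;
  [congr mktuple; apply/funext|apply: eq_map] => i.
- by rewrite interp_recE// leq_max leq_depth.
- by rewrite interp_recE// leq_max leq_depth orbT.
Qed.

Lemma interp_Ellipsis s n (G : var_symb L n) w x u v :
  interp s (Ellipsis G w x u v) =
  var_interp M G [tuple interp s (w i) | i < n]
    [seq interp s (subst x (Const k) u) | k <- iota 0 (interp s v).+1].
Proof.
rewrite {1}/interp [depth _]/=; set d := maxn _ _.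
have ud : depth u <= d by rewrite !leq_max leqnn !orbT.
have vd : depth v <= d by rewrite !leq_max leqnn !orbT.
rewrite [interp_rec _ _ _]/= -[interp_rec d s _ :: _]/(map _ (iota 0 _.+1)).
rewrite (interp_recE s vd); congr var_interp.
  by congr mktuple; apply/funext => i; rewrite interp_recE// leq_max leq_depth.
by apply: eq_map => k; rewrite interp_recE// depth_subst.
Qed.

Fixpoint sat s p : Prop :=
  match p with
  | Eq t u => interp s t = interp s u
  | Rel k R u => rel_interp M R [tuple interp s (u i) | i < k]
  | Not p => ~ sat s p
  | And p q => sat s p /\ sat s q
  | Or p q => sat s p \/ sat s q
  | Imp p q => sat s p -> sat s q
  | Iff p q => sat s p <-> sat s q
  | All x p => forall a : nat, sat [eta s with x |-> a] p
  | Ex x p => exists a : nat, sat [eta s with x |-> a] p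
  end.

Definition models p := forall s, sat s p.

End Semantics.

Definition nonempty_seq := {l : seq nat | l != [::]}.

Inductive bor_fun : nat -> Type :=
| Bf : bor_fun 1
| Bell n of 0 < n & (n.-tuple nat -> nonempty_seq) : bor_fun n.

Inductive bor_var : nat -> Type :=
| Btau n of 0 < n & (n.-tuple nat -> nonempty_seq) : bor_var n.

Definition L_Bor : language := Language bor_fun (fun=> void) bor_var.

Section BorStructure.
Variable f : nat -> nat.

Definition bor_fun_interp k (g : bor_fun k) : k.-tuple nat -> nat :=
  match g with
  | Bf => fun a => f (thead a)
  | Bell _ _ io => fun a => (size (val (io a))).-1
  end.

Definition bor_var_interp n (G : bor_var n) : n.-tuple nat -> seq nat -> nat :=
  match G with
  | Btau _ _ io => fun a b => if b == val (io a) then 1 else 0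
  end.

Definition M_ : structure L_Bor :=
  @Structure L_Bor bor_fun_interp
    (fun _ R => match (R : void) with end) bor_var_interp.

End BorStructure.

(* {ptws nat -> nat} is the space nat -> nat with the product topology, where
   nat is discrete. *)
Notation Baire := {ptws nat -> nat}.

Definition defines (p : formula L_Bor) (S : set Baire) :=
  forall f : nat -> nat, S f <-> models (M_ f) p.

(* Main.v *)
Require Import Defs.
From mathcomp Require Import all_boot all_classical topology.

(** From sentences to Borel sets: the value of a term of [L_Bor] is computed
    from finitely many values of [f], even when an ellipsis has a length that
    itself depends on [f], because near a given [f] that length is constant.
    A term is therefore a locally constant function of [f], and a
    quantifier-free formula defines a clopen set, whatever the assignment
    ([near_sat]).  A quantifier is a countable union or intersection, and a
    block of equal quantifiers stays within one class since [Sigma0 n] is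
    closed under countable unions; this gives [borel_prenex].  A sentence has
    the same truth value under all assignments ([sentence_models]), so that the
    set it defines is one of these sets.

    From Borel sets to sentences: the construction of a [Sigma0 n.+1] set as a
    countable union has to be made uniform in the index of the union, so the
    induction on [n] is carried out for families of sets indexed by the values
    of the first [k] variables ([definable]).  Each step of the hierarchy
    quantifies the variable [k], and the complementary class is served by the
    dual quantifier.  The language has symbols for arbitrary functions
    [iota], so that a formula can refer to an arbitrary family; this is why the
    classes obtained are the boldface ones.  At the bottom, an open set is
    a union of cylinders, and [f] lies in an open [U] iff
<<
      exists i, f extends the i-th sequence and the i-th cylinder is in U.
>>
    The first condition is tau(i, f(0), ..., f(l(i))) = 1, where tau and l come
    from an enumeration of the nonempty sequences ([starts_with_code]), and the
    second is an arbitrary relation between numbers, expressed by the length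
    symbol of a suitable [iota] ([test]). *)

Set Implicit Arguments.
Unset Strict Implicit.
Unset Printing Implicit Defensive.

Local Open Scope classical_set_scope.
Local Open Scope nat_scope.

(** * Finite Borel classes *)

Section BorelClasses.
Context {T : topologicalType}.
Implicit Types (b : bool) (n : nat) (A : set T).

(** The boolean follows the convention of [prenex], so that the two halves of
    the theorem become the instances of one statement. *)
Definition borel_class b n : set (set T) := if b then Sigma0 n else Pi0 n.

Lemma Sigma0_bigcup n (F : nat -> set T) : 0 < n ->
  (forall i, Sigma0 n (F i)) -> Sigma0 n (\bigcup_i F i).
Proof.
case: n => [//|[|n]] _ FS; first by apply: bigcup_open => i _; exact: FS.
have {}FS i : exists G : nat -> set T,
    (forall j, Pi0 n.+1 (G j)) /\ F i = \bigcup_j G j.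
  by have /Sigma0SS[G GP ->] := FS i; exists G.
have [G GP] := choice FS.
(* One union indexed by the codes of pairs replaces the two nested ones. *)
pose d k : nat * nat := odflt (0, 0) (unpickle k).
apply/Sigma0SS; exists (fun k => G (d k).1 (d k).2) => [k|].
  exact: (GP _).1.
rewrite eqEsubset; split => x [i _].
  rewrite (GP i).2 => -[j _ Gx]; exists (pickle (i, j)) => //.
  by rewrite /d pickleK.
by move=> Gx; exists (d i).1 => //; rewrite (GP _).2; exists (d i).2.
Qed.

(** This passes from the matrix of a quantifier block to the block; the
    repeated set makes it a countable union or intersection. *)
Lemma borel_class_next b n A : 0 < n ->
  borel_class (~~ b) n A -> borel_class b n.+1 A.
Proof.
have Pi0_Sigma0 B : 0 < n -> Pi0 n B -> Sigma0 n.+1 B.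
  case: n => [//|n] _ nB; apply/Sigma0SS; exists (fun=> B) => //.
  by rewrite bigcup_const.
case: b => [|n0 AS]; first exact: Pi0_Sigma0.
by apply: Pi0_Sigma0 => //; rewrite /Pi0 /= setCK.
Qed.

Lemma borel_class_nextP b n A : borel_class b n.+2 A ->
  exists F : nat -> set T, (forall i, borel_class (~~ b) n.+1 (F i)) /\
    A = if b then \bigcup_i F i else \bigcap_i F i.
Proof.
case: b => /= /Sigma0SS[F FP AF]; first by exists F.
by exists (fun i => ~` F i); split => //; rewrite -setC_bigcup -AF setCK.
Qed.

Lemma borel_class_quantifier b n (F : nat -> set T) : 0 < n ->
  (forall a, borel_class b n (F a)) ->
  borel_class b n (if b then \bigcup_a F a else \bigcap_a F a).
Proof.
case: b => n0 FB; first exact: Sigma0_bigcup.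
by rewrite /borel_class /Pi0 /= setC_bigcap; exact: Sigma0_bigcup.
Qed.

(** A locally constant condition holds near each point where it holds and fails
    near each point where it fails. *)
Lemma borel_class1 b (P : T -> Prop) :
  (forall f, \forall g \near f, P g <-> P f) -> borel_class b 1 [set f | P f].
Proof.
move=> Ploc; case: b; rewrite /borel_class /Pi0 /= openE => f /= Pf;
  by apply: filterS (Ploc f) => g /= ->.
Qed.

End BorelClasses.

(** * Dependence of terms and formulas on the assignment *)

Section Terms.
Context {L : language}.
Implicit Types (t : term L) (p : formula L).

(** The interpretation of an ellipsis refers to the terms u(x|k), which are not
    subterms; they have the depth of u, so that induction on the depth yields
    an induction hypothesis for each of them. *)
Lemma term_subst_ind (P : term L -> Prop) :
  (forall k, P (Const k)) -> (forall x, P (Var x)) ->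
  (forall k (f : fun_symb L k) u, (forall i, P (u i)) -> P (App f u)) ->
  (forall n (G : var_symb L n) w m (u : 'I_m -> term L),
     (forall i, P (w i)) -> (forall i, P (u i)) -> P (VApp G w u)) ->
  (forall n (G : var_symb L n) w x u v, (forall i, P (w i)) ->
     (forall k, P (subst x (Const k) u)) -> P v -> P (Ellipsis G w x u v)) ->
  forall t, P t.
Proof.
move=> PC PV PA PW PE t; have [d] := ubnP (depth t).
elim: d t => [//|d IH] [k|x|k f u|n G w m u|n G w x u v] //=.
- rewrite ltnS => ud; apply: PA => i; apply: IH.
  by apply: leq_ltn_trans ud; exact: leq_depth.
- rewrite ltnS gtn_max => /andP[wd ud].
  by apply: PW => i; apply: IH;
    [apply: leq_ltn_trans wd|apply: leq_ltn_trans ud]; exact: leq_depth.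
- rewrite ltnS !gtn_max => /and3P[wd ud vd].
  apply: PE => [i|k|]; apply: IH => //; last by rewrite depth_subst.
  by apply: leq_ltn_trans wd; exact: leq_depth.
Qed.

Lemma FV_subst_Const x k t : FV (subst x (Const k) t) `<=` FV t `\ x.
Proof.
elim: t => //= [y|n f u IHu|n G w IHw m u IHu|n G w IHw y u IHu v IHv] z.
- by case: eqVneq => //= yx ->; split => //; apply/eqP.
- by move=> [i _ /IHu[uz zx]]; split => //; exists i.
- by move=> [] [i _ /= /[dup] h]; [move=> /IHw|move=> /IHu] => -[uz zx];
    split => //; [left|right]; exists i.
- case=> [[[i _ /IHw[wz zx]]|]|/IHv[vz zx]].
  + by split => //; left; left; exists i.
  + case: eqVneq => [->|yx] [].
      by move=> uz zx; split => //; left; right.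
    by move=> /IHu[uz zx] zy; split => //; left; right.
  + by split => //; right.
Qed.

Variable M : structure L.

Lemma interp_FV t s s' : (forall x, FV t x -> s x = s' x) ->
  interp M s t = interp M s' t.
Proof.
elim/term_subst_ind: t s s' => //=.
- by move=> x s s'; apply.
- move=> k f u IH s s' ss'; rewrite !interp_App; congr fun_interp.
  by apply: eq_mktuple => i; apply: IH => x ux; apply: ss'; exists i.
- move=> n G w m u IHw IHu s s' ss'; rewrite !interp_VApp; congr var_interp.
    by apply: eq_mktuple => i; apply: IHw => x wx; apply: ss'; left; exists i.
  by apply: eq_map => i; apply: IHu => x ux; apply: ss'; right; exists i.
- move=> n G w y u v IHw IHu IHv s s' ss'; rewrite !interp_Ellipsis.
  congr var_interp.
    apply: eq_mktuple => i; apply: IHw => x wx; apply: ss'.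
    by left; left; exists i.
  rewrite (IHv s s') => [|x vx]; last by apply: ss'; right.
  apply: eq_map => k; apply: IHu => x /FV_subst_Const ux; apply: ss'.
  by left; right.
Qed.

Lemma sat_FV p s s' : (forall x, FVf p x -> s x = s' x) ->
  sat M s p <-> sat M s' p.
Proof.
have upd x (q : formula L) (a : nat) r r' :
    (forall y, (FVf q `\ x) y -> r y = r' y) ->
    forall y, FVf q y -> [eta r with x |-> a] y = [eta r' with x |-> a] y.
  by move=> rr' y qy /=; case: eqVneq => // /eqP yx; apply: rr'.
elim: p s s' => /= [t u|k R u|p IH|p IHp q IHq|p IHp q IHq|p IHp q IHq
                   |p IHp q IHq|x p IH|x p IH] s s' ss'.
- by rewrite (@interp_FV t s s') ?(@interp_FV u s s')// => x ?; apply: ss';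
    [right|left].
- have -> // : [tuple interp M s (u i) | i < k] =
               [tuple interp M s' (u i) | i < k].
  by apply: eq_mktuple => i; apply: interp_FV => x ux; apply: ss'; exists i.
- by rewrite (IH s s').
- by rewrite (IHp s s') ?(IHq s s')// => x ?; apply: ss'; [right|left].
- by rewrite (IHp s s') ?(IHq s s')// => x ?; apply: ss'; [right|left].
- by rewrite (IHp s s') ?(IHq s s')// => x ?; apply: ss'; [right|left].
- by rewrite (IHp s s') ?(IHq s s')// => x ?; apply: ss'; [right|left].
- have e a := IH _ _ (upd x p a s s' ss').
  by split=> h a; have := h a; move/e.
- have e a := IH _ _ (upd x p a s s' ss').
  by split=> -[a /e h]; exists a.
Qed.

Lemma sentence_models p s : sentence p -> models M p <-> sat M s p.
Proof.
move=> p0; split => [|h s']; first exact.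
by rewrite (@sat_FV p s' s)// p0.
Qed.

End Terms.

(** * Prenex formulas define Borel sets *)

Section Baire.
Implicit Types (f g : Baire) (s : nat -> nat).

(** The evaluation at x is a projection of the product, and singletons of [nat]
    are open. *)
Lemma near_value f x : \forall g \near f, g x = f x.
Proof.
exact: (@proj_continuous _ (fun=> nat) x f [set f x] (discrete_set1 _)).
Qed.

Section Limit.
Variables (F : set_system (nat -> nat)) (f : nat -> nat).
Context {FF : Filter F} (Ff : forall x, \forall g \near F, g x = f x).

(** Convergence of F to f matters only through the values of f, one at a time:
    f is applied to a value of a term, which by induction is eventually the
    value at the limit. *)
Lemma near_interp s t :
  \forall g \near F, interp (M_ g) s t = interp (M_ f) s t.
Proof.
elim/(@term_subst_ind L_Bor): t
  => [k|x|k h u IH|n G w m u IHw IHu|n G w x u v IHw IHu IHv].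
- exact: nearW.
- exact: nearW.
- have := @filter_forall _ _ _ F FF IH; case: h u IH => [|n n0 io] u _ nu.
    set a := interp (M_ f) s (u ord0).
    apply: filterS2 (Ff a) nu => g gf /(_ ord0) gu.
    rewrite !interp_App /= /thead !tnth_mktuple gu; exact: gf.
  apply: filterS nu => g gu; rewrite !interp_App /=.
  by rewrite (eq_mktuple _ gu).
- have nw := @filter_forall _ _ _ F FF IHw.
  have nu := @filter_forall _ _ _ F FF IHu.
  apply: filterS2 nw nu => g gw gu.
  by rewrite !interp_VApp (eq_mktuple _ gw) (eq_mktuple _ gu).
- have uN N : \forall g \near F, forall k, k < N ->
      interp (M_ g) s (subst x (Const k) u) =
      interp (M_ f) s (subst x (Const k) u).
    elim: N => [|N IHN]; first exact: nearW.
    by apply: filterS2 IHN (IHu N) => g gN gu k; rewrite ltnS leq_eqVlt =>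
      /predU1P[->|/gN].
  have nw := @filter_forall _ _ _ F FF IHw.
  (* Only finitely many entries matter, as many as the value of v at f. *)
  apply: filterS3 nw (uN (interp (M_ f) s v).+1) IHv => g gw gu gv.
  rewrite !interp_Ellipsis gv (eq_mktuple _ gw).
  congr (bor_var_interp _ _ _); apply/eq_in_map => k.
  by rewrite mem_iota add0n => /gu.
Qed.

Lemma near_sat s p : quantifier_free p ->
  \forall g \near F, sat (M_ g) s p <-> sat (M_ f) s p.
Proof.
elim: p => //= [t u _|p IH qp|p IHp q IHq|p IHp q IHq
               |p IHp q IHq|p IHp q IHq].
- by apply: filterS2 (near_interp s t) (near_interp s u) => g -> ->.
- by apply: filterS (IH qp) => g ->.
all: by case=> qp qq; apply: filterS2 (IHp qp) (IHq qq) => g -> ->.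
Qed.

End Limit.

Lemma borel_prenex b n p s : 0 < n -> prenex b n p ->
  borel_class b n [set f : Baire | sat (M_ f) s p].
Proof.
elim: n b p s => [//|n IH] b p s _ /= [xs [q [_ qn ->]]].
have {IH} qB s' : borel_class b n.+1 [set f : Baire | sat (M_ f) s' q].
  case: n IH qn => [_|n IH] qn; last first.
    exact: (@borel_class_next _ b n.+1 _ isT (IH _ _ _ isT qn)).
  by apply: borel_class1 => f; exact: (near_sat (near_value f) s' qn).
elim: xs s => [|x xs IHxs] s //=.
have := @borel_class_quantifier _ b n.+1
  (fun a => [set f : Baire |
    sat (M_ f) [eta s with x |-> a] (foldr (quantifier b) q xs)])
  isT (fun a => IHxs _).
congr borel_class; case: (b); rewrite eqEsubset; split => f /=.
- by move=> [a _ h]; exists a.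
- by move=> [a h]; exists a.
- by move=> h a; exact: h.
- by move=> h a _; exact: h.
Qed.

End Baire.

(** * Borel sets are defined by prenex formulas *)

Section Definability.
Implicit Types (A : seq nat -> set Baire) (s : nat -> nat).

(** An open set contains a basic neighbourhood of each of its points: the
    filter generated by the sets of sequences sharing a prefix with f converges
    to f pointwise, hence in the product topology. *)
Lemma open_prefix (U : set Baire) (f : Baire) : open U -> U f ->
  exists N, forall g, mkseq g N = mkseq f N -> U g.
Proof.
move=> oU Uf; pose C N := [set g : Baire | mkseq g N = mkseq f N].
have mkseq_prefix g N : C N g <-> forall i, i < N -> g i = f i.
  split => [gf i iN|gf].
    by rewrite -(nth_mkseq 0 g iN) -(nth_mkseq 0 f iN) gf.
  by apply/eq_in_map => i; rewrite mem_iota add0n => /gf.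
pose F := filter_from setT C.
have FF : Filter F.
  apply: filter_from_filter => [|i j _ _]; first by exists 0.
  exists (maxn i j) => // g /mkseq_prefix gf.
  by split; apply/mkseq_prefix => k kl; apply: gf; rewrite leq_max kl ?orbT.
have Ff : {ptws, F --> f}.
  apply/pointwise_cvgP => x.
  have : (fun g : nat -> nat => g x) @ F --> f x.
    apply/discrete_cvg; exists x.+1 => // g /mkseq_prefix gf.
    exact: gf.
  exact.
have [N _ CU] : F U by apply: Ff; exact: open_nbhs_nbhs.
by exists N => g /CU.
Qed.

(** A code is decoded to a head and a tail, since the symbols of [L_Bor] need
    nonempty values. *)
Definition prefix_of_code (i : nat) : nonempty_seq :=
  let: (h, l) := odflt (0, [::]) (unpickle i) in exist _ (h :: l) isT.

Definition cylinder (l : seq nat) : set Baire :=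
  [set f | mkseq f (size l) = l].

(** A prefix of length [N.+1] is used, rather than [N], because a code stands
    for a nonempty sequence. *)
Lemma open_cylinders (U : set Baire) (f : Baire) : open U ->
  U f <-> exists i, cylinder (val (prefix_of_code i)) f /\
                    cylinder (val (prefix_of_code i)) `<=` U.
Proof.
move=> oU; split=> [Uf|[i [fi iU]]]; last exact: iU.
have [N NU] := open_prefix oU Uf.
exists (pickle (f 0, behead (mkseq f N.+1))).
rewrite /prefix_of_code pickleK /= /cylinder /= size_map size_iota.
split => // g /= [g0 gf]; apply: NU.
have: mkseq g N.+1 = mkseq f N.+1 by rewrite /mkseq /= g0 gf.
by move=> /(congr1 (take N)); rewrite -!map_take !take_iota (minn_idPl _).
Qed.

(** The symbol denotes a length minus 1, so that sequences of lengths 2 and 1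
    encode the truth values 1 and 0. *)
Definition test_fun k (P : seq nat -> Prop) : fun_symb L_Bor k.+1 :=
  @Bell k.+1 isT (fun a => if `[< P (val a) >]
                          then exist _ [:: 0; 0] isT else exist _ [:: 0] isT).

Definition test k (P : seq nat -> Prop) : formula L_Bor :=
  Eq (App (test_fun k P) (fun i => Var i)) (Const 1).

Lemma map_enum_ord_mkseq k s : [seq s (val i) | i <- enum 'I_k] = mkseq s k.
Proof. by rewrite map_comp val_enum_ord. Qed.

Lemma sat_test k P f s : sat (M_ f) s (test k P) <-> P (mkseq s k.+1).
Proof.
rewrite /= interp_App /=.
rewrite [X in P X](_ : _ = mkseq s k.+1); last exact: map_enum_ord_mkseq.
by split; case: asboolP.
Qed.

(** The formula tau(x_k, f(0), ..., f(l(x_k))) = 1.  The ellipsis may bind x_0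
    even when k = 0, because it binds that variable in f(x_0) only. *)
Definition starts_with_code k : formula L_Bor :=
  let io (a : 1.-tuple nat) := prefix_of_code (thead a) in
  let w (_ : 'I_1) : term L_Bor := Var k in
  Eq (@Ellipsis L_Bor 1 (@Btau 1 isT io) w 0
        (@App L_Bor 1 Bf (fun=> Var 0)) (@App L_Bor 1 (@Bell 1 isT io) w))
     (Const 1).

Lemma sat_starts_with_code k f s :
  sat (M_ f) s (starts_with_code k) <->
  cylinder (val (prefix_of_code (s k))) f.
Proof.
rewrite /= interp_Ellipsis interp_App /= /thead !tnth_mktuple !interp_Var.
have ff j : interp (M_ f) s (@App L_Bor 1 Bf (fun=> Const j)) = f j.
  by rewrite interp_App /= /thead tnth_mktuple.
rewrite ff (eq_map ff) /cylinder.
by case: (prefix_of_code _) => -[//|h l] /= _; split=> [|<-];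
  rewrite ?eqxx//; case: eqP.
Qed.

Lemma FV_test k P : FVf (test k P) `<=` [set x | x < k.+1].
Proof. by move=> x /= [[i _ ->]|//]. Qed.

Lemma FV_starts_with_code k : FVf (starts_with_code k) `<=` [set x | x < k.+1].
Proof.
by move=> x /= [[[[i _ ->]|[[i _ /= ->]]]|[i _ ->]]|]; rewrite //= ltnSn.
Qed.

Definition defines_family k p A := FVf p `<=` [set x | x < k] /\
  forall f s, sat (M_ f) s p <-> A (mkseq s k) f.

Lemma mkseq_upd s k a : mkseq [eta s with k |-> a] k.+1 = rcons (mkseq s k) a.
Proof.
rewrite mkseqS /= eqxx; congr rcons; apply/eq_in_map => i.
by rewrite mem_iota add0n /= => ik; rewrite ltn_eqF.
Qed.

(** The last argument of the tested relation is the witness x_k, a code; the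
    first k arguments select the member of the family. *)
Lemma open_definable k A : (forall l, open (A l)) ->
  exists q, [/\ quantifier_free q, FVf q `<=` [set x | x < k.+1] &
    forall f s, A (mkseq s k) f <->
      exists a, sat (M_ f) [eta s with k |-> a] q].
Proof.
move=> oA; pose P l :=
  cylinder (val (prefix_of_code (last 0 l))) `<=` A (take k l).
exists (And (starts_with_code k) (test k P)); split=> // [x [|]|f s].
- exact: FV_starts_with_code.
- exact: FV_test.
have aP a : P (mkseq [eta s with k |-> a] k.+1) <->
    cylinder (val (prefix_of_code a)) `<=` A (mkseq s k).
  by rewrite /P mkseq_upd last_rcons -cats1 take_size_cat ?size_mkseq.
rewrite (open_cylinders f (oA _)); split=> -[a [fa aA]]; exists a; split.
- by apply/sat_starts_with_code; rewrite /= eqxx.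
- by apply/sat_test/aP.
- by move/sat_starts_with_code: fa; rewrite /= eqxx.
- by apply/aP/(@sat_test _ _ f).
Qed.

(** The induction replaces a family A_l of level n + 2 by the family F_{l,a} of
    level n + 1 with A_l the union, or the intersection, of the F_{l,a} over a;
    the index a becomes the value of one more variable. *)
Lemma definable b n k A : 0 < n -> (forall l, borel_class b n (A l)) ->
  exists2 p, prenex b n p & defines_family k p A.
Proof.
elim: n b k A => [//|n IH] b k A _ Ab.
suff [q qn [qFV qA]] : exists2 q, prenex (~~ b) n q &
    FVf q `<=` [set x | x < k.+1] /\
    forall f s, A (mkseq s k) f <->
      if b then exists a, sat (M_ f) [eta s with k |-> a] q
      else forall a, sat (M_ f) [eta s with k |-> a] q.
  exists (quantifier b k q); first by exists [:: k], q.
  split=> [x|f s]; last by rewrite qA; case: (b).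
  rewrite (_ : FVf _ = FVf q `\ k); last by case: (b).
  by case=> /qFV /= xk /eqP kx; rewrite ltn_neqAle kx.
case: n IH Ab => [_|n IH] Ab.
  case: b Ab => Ab.
    by have [q [q0 qFV qA]] := open_definable k Ab; exists q.
  have [q [q0 qFV qA]] := @open_definable k (fun l => ~` A l) Ab.
  exists (Not q) => //; split => // f s.
  rewrite -[A _ f]notK.
  by split=> [nA a fa|h /qA[a]]; [apply: nA; apply/qA; exists a|exact: h].
have [F FA] := choice (fun l => borel_class_nextP (Ab l)).
have [q qn [qFV qF]] := IH (~~ b) k.+1 (fun l => F (take k l) (last 0 l)) isT
  (fun l => (FA _).1 _).
exists q => //; split => // f s; rewrite (FA _).2.
have {}qF a : sat (M_ f) [eta s with k |-> a] q <-> F (mkseq s k) a f.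
  by rewrite qF mkseq_upd last_rcons -cats1 take_size_cat ?size_mkseq.
case: (b); split.
- by case=> a _ /qF; exists a.
- by case=> a /qF; exists a.
- by move=> h a; apply/qF/h.
- by move=> h a _; apply/qF/h.
Qed.

End Definability.

Theorem theorem15 (n : nat) (S : set Baire) (n_gt0 : (0 < n)%N) :
  (Sigma0 n S <-> exists p : formula L_Bor, is_Sigma n p /\ defines p S) /\
  (Pi0 n S <-> exists p : formula L_Bor, is_Pi n p /\ defines p S).
Proof.
suff E b : borel_class b n S <->
    exists p : formula L_Bor, (sentence p /\ prenex b n p) /\ defines p S.
  by split; [exact: (E true)|exact: (E false)].
split=> [Sb|[p [[p0 pn] pS]]].
  have [p pn [pFV pS]] := definable 0 n_gt0 (fun=> Sb).
  have p0 : sentence p by rewrite /sentence -subset0 => x /pFV.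
  exists p; split=> // f.
  by rewrite (sentence_models (M_ f) (fun=> 0) p0) pS.
rewrite (_ : S = [set f : Baire | sat (M_ f) (fun=> 0) p]).
  exact: borel_prenex.
by apply/seteqP; split=> f /=; rewrite pS (sentence_models _ (fun=> 0)).
Qed.
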